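(* Let $G$ be an infinite, finitely generated, amenable group and let $\alpha\in[0,1]$. Then there exists a non-empty $G$-subshift $X_\alpha\subset\{0,1\}^G$ such that for every $x\in X_\alpha$ and every Følner sequence $(F_n)_{n\in\mathbb N}$ of $G$, $$\lim_{n\to\infty}\operatorname{dens}(1,F_n,x)=\alpha.$$
   Context: $\{0,1\}^G$ carries the product topology and the shift action $(\sigma_g(x))_h=x_{g^{-1}h}$. A $G$-subshift is a closed subset of $\{0,1\}^G$ invariant under all $\sigma_g$, $g\in G$. For a finite non-empty $F\subset G$ and $x\in\{0,1\}^G$, $\operatorname{dens}(1,F,x)=\frac{|\{g\in F\mid x_g=1\}|}{|F|}$. For finite subsets $F,K\subset G$ let $\mathrm{Int}(F,K)=\{g\in F\mid\forall k\in K,\ gk\in F\}$ and $\partial_KF=F\setminus\mathrm{Int}(F,K)$. A Følner sequence is a sequence $(F_n)_{n\in\mathbb N}$ of non-empty finite subsets of $G$ such that for every finite $K\subset G$, $\lim_{n\to\infty}\frac{|\partial_KF_n|}{|F_n|}=0$. *)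

(* Defs.v *)
From HB Require Import structures.
From mathcomp Require Import all_boot all_order all_algebra.
From mathcomp Require Import finmap.
From mathcomp Require Import all_classical all_reals all_analysis.
Import Order.TTheory GRing.Theory Num.Theory.
Import numFieldNormedType.Exports.

Set Implicit Arguments.
Unset Strict Implicit.
Unset Printing Implicit Defensive.

Local Open Scope classical_set_scope.
Local Open Scope ring_scope.

Definition finitely_generated (G : groupType) : Prop :=
  exists S : {fset G}, forall H : {pred G},
    group_closed H -> {subset S <= H} -> forall g : G, g \in H.

Definition Fint (G : groupType) (F K : {fset G}) : {fset G} :=
  [fset g in F | all (fun k => (g * k)%g \in F) K]%fset.

Definition Fboundary (G : groupType) (K F : {fset G}) : {fset G} :=
  (F `\` Fint F K)%fset.

Definition Folner (R : realType) (G : groupType) (F : nat -> {fset G}) : Prop :=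
  (forall n, F n != fset0%fset) /\
  forall K : {fset G},
    (fun n => #|` Fboundary K (F n)|%:R / #|` F n|%:R : R) @ \oo --> (0 : R).

(* Amenability by Følner sequences, as is standard for countable groups (which
   finitely generated groups are). *)
Definition amenable (R : realType) (G : groupType) : Prop :=
  exists F : nat -> {fset G}, Folner R F.

(* {ptws G -> bool} carries the product topology, bool being discrete. *)
Notation config G := {ptws G -> bool}.

Definition gshift (G : groupType) (g : G) (x : config G) : config G :=
  fun h => x (g^-1 * h)%g.

Definition subshift (G : groupType) (X : set (config G)) : Prop :=
  closed X /\ forall g : G, gshift g @` X `<=` X.

Definition dens1 (R : realType) (G : groupType) (F : {fset G}) (x : config G) : R :=
  #|` [fset g in F | x g]%fset|%:R / #|` F|%:R.

(* Main.v *)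
(* X is the set of configurations x such that, for every finite F, the sum of
   x - alpha over F is at most 2 |bd_K F| in absolute value, where K is the ball
   of radius 3. This set is closed and shift-invariant, and all its members have
   density alpha along every Folner sequence. By compactness it is non-empty as
   soon as these inequalities can be met for all F inside a given finite set.
   For that, cover the finite set by an injective path g_0, g_1, ... with jumps
   of length at most 3 and give x the value floor ((i+1) alpha) - floor (i alpha)
   at g_i: the sum of x - alpha over a run of consecutive points of the path is
   at most 1 in absolute value, and each run of F but possibly the last one ends
   in bd_K F. *)

Require Import Defs.
From HB Require Import structures.
From mathcomp Require Import all_boot all_order all_algebra.
From mathcomp Require Import finmap.
From mathcomp Require Import all_classical all_reals all_analysis.
From mathcomp Require Import zify lra.
Import Order.TTheory GRing.Theory Num.Theory.
Import numFieldNormedType.Exports.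

Set Implicit Arguments.
Unset Strict Implicit.
Unset Printing Implicit Defensive.

Local Open Scope classical_set_scope.
Local Open Scope ring_scope.

(** * Sums over runs of consecutive indices *)

(** A run of [b] from i to j - 1 telescopes to [phi i - phi j], which lies between -1 and 1. [E]
    counts the runs that end before [n]; the terms in [b n] account for a run still open at [n],
    whose part so far is [phi i - phi n]. *)
Lemma prefix_sum_bound (R : realDomainType) (b : nat -> bool) (phi : nat -> R)
    (phi01 : forall i, 0 <= phi i <= 1) (n : nat) :
  let E := \sum_(i < n) ((b i && ~~ b i.+1)%:R : R) in
  let S := \sum_(i < n) (b i)%:R * (phi i - phi i.+1) in
  - E - (b n)%:R * phi n <= S <= E + (b n)%:R * (1 - phi n).
Proof.
elim: n => [|n IHn] /=.
  rewrite !big_ord0; have := phi01 0%N; case: (b 0%N) => /=; lra.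
rewrite !big_ord_recr /=; move: IHn => /=.
set E := \sum_(i < n) _; set S := \sum_(i < n) _.
have := phi01 n; have := phi01 n.+1.
by case: (b n); case: (b n.+1) => /=; lra.
Qed.

(** * Word balls and paths with jumps of length at most 3 *)

Fixpoint ball (G : groupType) (T : {fset G}) (n : nat) : {fset G} :=
  if n is m.+1 then [fset (x * y)%g | x in ball T m, y in T]%fset
  else [fset 1%g]%fset.
Arguments ball : simpl never.

Section Balls.
Context (G : groupType) (T : {fset G}).
Hypotheses (T1 : 1%g \in T) (TV : forall t, t \in T -> t^-1%g \in T).

Lemma ball0 x : (x \in ball T 0) = (x == 1%g).
Proof. by rewrite /ball inE. Qed.

Lemma ball_mulr n x t : x \in ball T n -> t \in T -> (x * t)%g \in ball T n.+1.
Proof. by move=> xn tT; apply: in_imfset2. Qed.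

Lemma ball_mull n x t : x \in ball T n -> t \in T -> (t * x)%g \in ball T n.+1.
Proof.
elim: n x => [|n IHn] x xn tT.
  move: xn; rewrite ball0 => /eqP ->.
  by rewrite mulg1 -[t]mul1g; apply: ball_mulr; rewrite ?ball0.
have /imfset2P[y /= yn [u /= uT ->]] := xn.
by rewrite mulgA; apply: ball_mulr => //; apply: IHn.
Qed.

Lemma ball_mono m n : (m <= n)%N -> {subset ball T m <= ball T n}.
Proof.
move=> /subnK <-; elim: (n - m)%N => // k IHk x /IHk xk.
by rewrite -[x]mulg1; apply: ball_mulr.
Qed.

Lemma ball1 t : t \in T -> t \in ball T 1.
Proof. by move=> tT; rewrite -[t]mul1g; apply: ball_mulr; rewrite ?ball0. Qed.

(* Sekanina's Hamiltonian path in the cube of a tree lists each vertex of even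
   depth before its descendants and each one of odd depth after them. The colour
   is the parity of the depth; with the bounds 1, 2, 2, 3 according to colours,
   a leaf can be inserted right next to its parent. *)
Definition step (p q : G * bool) : bool :=
  (p.1^-1 * q.1)%g \in ball T (1 + p.2 + ~~ q.2).

Definition coloured_path (s : seq (G * bool)) : bool :=
  uniq (map fst s) && sorted step s.

Lemma step_ball3 p q : step p q -> (p.1^-1 * q.1)%g \in ball T 3.
Proof. by apply: ball_mono; case: p.2; case: q.2. Qed.

(** [w] gets the colour opposite to that of [v], and goes just before [v] if that colour is [true],
    just after it if [false]. The step between [v] and [w] then has bound 1, and the other new step
    has a bound larger by 1 than the step it replaces, which pays for the detour. *)
Lemma coloured_path_insert s v0 w :
    coloured_path s -> v0 \in map fst s -> (v0^-1 * w)%g \in T ->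
  exists2 s', coloured_path s' & {subset w :: map fst s <= map fst s'}.
Proof.
move=> sP; have [ws _ _|ws] := boolP (w \in map fst s).
  by exists s => // x; rewrite inE => /predU1P[->|].
case/mapP=> -[v c] vs /= -> {v0} vw.
have wv : (w^-1 * v)%g \in T by rewrite -[v]invgK -invgM TV.
suff [s' ss' sw] : exists2 s', sorted step s' &
    perm_eq (map fst s') (w :: map fst s).
  exists s'; last by move=> x; rewrite (perm_mem sw).
  by rewrite /coloured_path ss' (perm_uniq sw) /= ws; case/andP: sP => ->.
case/andP: sP => _; case: (splitPr vs) => p1 p2; rewrite sorted_cat_cons => /andP[].
case: c {vs} => [s1 s2|s1].
- exists (p1 ++ (w, false) :: (v, true) :: p2).
    rewrite sorted_cat_cons /= s2 andbT; apply/andP; split; last exact: ball1.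
    case/lastP: p1 s1 => // p1 u; rewrite -!cats1 -!catA /=.
    rewrite !sorted_cat_cons /= => /andP[-> /andP[uv _]]; rewrite andbT.
    move: uv; rewrite /step /= addn0 addn1 => uv.
    by rewrite -[w](mulVKg v) mulgA; apply: ball_mulr.
  by apply/permP => a; rewrite /= !map_cat !count_cat /=; lia.
exists (p1 ++ (v, false) :: (w, true) :: p2).
  rewrite sorted_cat_cons s1 /=; apply/andP; split; first exact: ball1.
  case: p2 b => //= u p2 /andP[vu ->]; rewrite andbT.
  move: vu; rewrite /step /= => vu.
  by rewrite -[u.1](mulVKg v) mulgA; apply: ball_mull.
by apply/permP => a; rewrite /= !map_cat !count_cat /=; lia.
Qed.

Hypothesis Tgen : forall H : {pred G},
  group_closed H -> {subset T <= H} -> forall g, g \in H.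

(** Each point of [l] is joined to 1, already on the path, by a word in [T] whose prefixes are
    inserted one after the other. [P h] allows any starting point [g], so that words can be
    concatenated. *)
Lemma coloured_path_cover (l : seq G) :
  exists2 s, coloured_path s & {subset l <= map fst s}.
Proof.
pose P h := forall g s, coloured_path s -> g \in map fst s ->
  exists2 s', coloured_path s' & {subset (g * h)%g :: map fst s <= map fst s'}.
have P1 : P 1%g.
  move=> g s sP gs; exists s => // x; rewrite inE mulg1.
  by move=> /predU1P[->|].
have PM h k : P h -> P k -> P (h * k)%g.
  move=> Ph Pk g s sP gs; have [s1 s1P s1s] := Ph g s sP gs.
  have [|s2 s2P s2s] := Pk (g * h)%g s1 s1P; first by rewrite s1s ?mem_head.
  exists s2 => // x; rewrite inE mulgA => /predU1P[->|xs].
    by rewrite s2s ?mem_head.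
  by rewrite s2s // inE s1s ?orbT // inE xs orbT.
have PT t : t \in T -> P t.
  move=> tT g s sP gs; apply: coloured_path_insert sP gs _.
  by rewrite mulKg.
have Pall h : P h.
  (* Stability of [P] under inverses is not immediate; asking for [P] at both [h] and its inverse
     gives a subgroup, which contains the symmetric set [T]. *)
  suff /asboolP[] : h \in (fun h => `[< P h /\ P h^-1%g >]) by [].
  apply: Tgen => [|t tT]; last first.
    by apply/asboolP; split; apply: PT => //; apply: TV.
  split; first by apply/asboolP; rewrite invg1.
  move=> x y /asboolP[Px Px'] /asboolP[Py Py']; apply/asboolP.
  by rewrite invgM invgK; split; apply: PM.
suff [s sP sl] : exists2 s, coloured_path s & {subset 1%g :: l <= map fst s}.
  by exists s => // x xl; rewrite sl // inE xl orbT.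
elim: l => [|g l [s sP sl]].
  by exists [:: (1%g, false)] => // x.
have [|s' s'P s's] := Pall g 1%g s sP; first by rewrite sl ?mem_head.
exists s' => // x; rewrite !inE => /or3P[/eqP ->|/eqP ->|xl]; apply: s's.
- by rewrite inE sl ?orbT ?mem_head.
- by rewrite mul1g mem_head.
- by rewrite inE sl ?orbT // inE xl orbT.
Qed.

(** If the boundary were empty, [F] would be invariant under right translation by [T], hence by the
    whole group, and would contain all [f * g], making the group finite. *)
Lemma Fboundary_neq0 (K F : {fset G}) :
    infinite_set [set: G] -> {subset T <= K} -> F != fset0 ->
  Fboundary K F != fset0.
Proof.
move=> Ginf TK /fset0Pn[f fF]; apply/negP => /eqP bd0; apply: Ginf.
have FK g k : g \in F -> k \in K -> (g * k)%g \in F.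
  move=> gF kK; have : g \in Fint F K.
    by apply: contraT => gI; move: (in_fset0 g); rewrite -bd0 in_fsetD gI gF.
  by rewrite !inE => /andP[_ /allP]; apply.
have FH h g : ((g * h)%g \in F) = (g \in F).
  suff /asboolP : h \in (fun h => `[< forall g, ((g * h)%g \in F) = (g \in F) >]).
    by [].
  apply: Tgen => [|t tT].
    split; first by apply/asboolP => ?; rewrite mulg1.
    move=> x y /asboolP Px /asboolP Py; apply/asboolP => z.
    by rewrite mulgA -Py mulgVK.
  apply/asboolP => z; apply/idP/idP => [zt|zF]; last exact/FK/TK.
  by rewrite -[z](mulgK t); apply: FK => //; apply/TK/TV.
apply: (sub_finite_set _ (finite_fset [fset (f^-1 * g)%g | g in F]%fset)).
move=> g _ /=; apply/imfsetP; exists (f * g)%g; last by rewrite mulKg.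
by rewrite FH.
Qed.
End Balls.

(** * Balanced configurations along a path *)

Lemma path_rounding (R : realType) (alpha : R) (G : groupType) (K : {fset G})
    (s : seq G) :
    0 <= alpha <= 1 -> uniq s -> sorted (fun g h => (g^-1 * h)%g \in K) s ->
  exists x : G -> bool, forall F : {fset G}, {subset F <= s} ->
    `|\sum_(g <- F) ((x g)%:R - alpha)| <= (#|` Fboundary K F|.+1)%:R.
Proof.
move=> alpha01 us ss.
pose a i : int := Num.floor (i%:R * alpha).
pose phi i : R := i%:R * alpha - (a i)%:~R.
have phi01 i : 0 <= phi i <= 1.
  by have := floor_itv (i%:R * alpha); rewrite intrD /phi -/(a i); lra.
(* As [alpha] lies in [0,1], consecutive floors differ by 0 or 1, so the boolean [a i != a i.+1] is
   the increment. *)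
have phiS i : (a i != a i.+1)%:R - alpha = phi i - phi i.+1.
  have ai := floor_itv (i%:R * alpha); have aS := floor_itv (i.+1%:R * alpha).
  move: ai aS; rewrite /phi -!/(a _) -natr1 mulrDl mul1r !intrD => ai aS.
  have : (a i <= a i.+1)%R by rewrite -ltzD1 -(ltr_int R) intrD; lra.
  have : (a i.+1 < a i + 2)%R by rewrite -(ltr_int R) intrD; lra.
  case: eqVneq => [->|ne lt le] /=; first lra.
  have -> : a i.+1 = a i + 1 by lia.
  rewrite intrD; lra.
(* Outside [s] the index is [size s]; this default value is never read, since [F] lies in [s]. *)
exists (fun g => a (index g s) != a (index g s).+1) => F Fs.
pose b i := (i < size s)%N && (nth 1%g s i \in F).
have -> : \sum_(g <- F) ((a (index g s) != a (index g s).+1)%:R - alpha) =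
    \sum_(i < size s) (b i)%:R * (phi i - phi i.+1).
  have pF : perm_eq F [seq g <- s | g \in F].
    apply: uniq_perm; rewrite ?fset_uniq ?filter_uniq // => g.
    by rewrite mem_filter; case gF : (g \in F) => //=; rewrite Fs.
  rewrite (perm_big _ pF) big_filter (big_nth 1%g) big_mkord big_mkcond /=.
  apply: eq_bigr => i _; rewrite /b ltn_ord /= index_uniq // phiS.
  by case: ifP; rewrite ?mul1r ?mul0r.
have /= := prefix_sum_bound b phi01 (size s).
have -> : b (size s) = false by rewrite /b ltnn.
rewrite !mul0r subr0 addr0.
set S := \sum_(i < _) _ * _; set E := \sum_(i < _) _ => SE.
suff : E <= (#|` Fboundary K F|.+1)%:R by rewrite ler_norml; lra.
rewrite /E -natr_sum ler_nat.
case sz : (size s) => [|n]; first by rewrite big_ord0.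
(* The last point of the path may end a run without lying in the boundary; this is the extra 1 in
   the bound. *)
rewrite big_ord_recr /= -[X in (_ <= X)%N]addn1 leq_add ?leq_b1 //.
apply: (@leq_trans (\sum_(i < n) (nth 1%g s i \in Fboundary K F))).
  apply: leq_sum => i _; have iS : (i.+1 < size s)%N by rewrite sz ltnS.
  rewrite /b iS (ltnW iS) /=; case: (boolP (_ && _)) => // /andP[siF sSF].
  rewrite !inE siF /= andbT lt0b; apply: contra sSF => /allP sK.
  have /sK : ((nth 1 s i)^-1 * nth 1 s i.+1)%g \in K by move/sortedP: ss; apply.
  by rewrite mulVKg.
apply: (@leq_trans (count [in Fboundary K F] s)).
  rewrite -sum1_count [leqRHS]big_mkcond (big_nth 1%g) big_mkord sz big_ord_recr /=.
  by apply: leq_trans (leq_addr _ _); apply: leq_sum => i _; case: (_ \in _).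
rewrite -size_filter uniq_leq_size ?filter_uniq // => g.
by rewrite mem_filter => /andP[].
Qed.

(** * Closed shift-invariant conditions that force the density *)

(** The factor 2 absorbs the extra 1 of [path_rounding] once the boundary is known to be
    non-empty. *)
Definition discrepancy_le (R : realType) (alpha : R) (G : groupType)
    (K F : {fset G}) : set (config G) :=
  [set x | `|\sum_(g <- F) ((x g)%:R - alpha)| <= (2 * #|` Fboundary K F|)%:R].

Lemma discrepancy_le_closed (R : realType) (alpha : R) (G : groupType)
    (K F : {fset G}) : closed (discrepancy_le alpha K F).
Proof.
pose f (x : config G) : R := \sum_(g <- F) ((x g)%:R - alpha).
apply: (@preimage_closed _ _ (fun x => `|f x|)
  [set r | r <= (2 * #|` Fboundary K F|)%:R]); last exact: closed_le.
move=> x _; apply: continuous_comp; last exact: norm_continuous.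
apply: cvg_big => [|g _]; first exact: add_continuous.
apply: cvgB; last exact: cvg_cst.
apply: (@cvg_comp _ _ _ (fun y : config G => y g) (fun c : bool => c%:R : R)).
  exact: (@proj_continuous G (fun=> bool) g).
(* [bool] is discrete: the singleton of [x g] is a neighbourhood. *)
move=> A /nbhs_singleton Ax; 
by have := discrete_set1 (x g); apply: (@filterS _ (nbhs (x g)) _) => c ->.
Qed.

(** Interiors are defined by right multiplication, which commutes with left translation. *)
Lemma Fboundary_mulg (G : groupType) (K F : {fset G}) (h : G) :
  Fboundary K [fset (h * g)%g | g in F]%fset =
  [fset (h * g)%g | g in Fboundary K F]%fset.
Proof.
have memE (A : {fset G}) g :
    (g \in [fset (h * g)%g | g in A]%fset) = ((h^-1 * g)%g \in A).
  apply/imfsetP/idP => [[y yA ->]|hgA]; first by rewrite mulKg.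
  by exists (h^-1 * g)%g; rewrite ?mulVKg.
apply/fsetP => g; rewrite memE !inE !memE; congr (~~ (_ && _) && _).
by apply: eq_all => k; rewrite memE mulgA.
Qed.

Lemma discrepancy_le_gshift (R : realType) (alpha : R) (G : groupType)
    (K F : {fset G}) (h : G) (x : config G) :
  discrepancy_le alpha K [fset (h^-1 * g)%g | g in F]%fset x ->
  discrepancy_le alpha K F (gshift h x).
Proof.
rewrite /discrepancy_le /= Fboundary_mulg (card_imfset _ _ (@mulgI _ h^-1%g)) /=.
by rewrite big_imfset //= => ? ? _ _; apply: mulgI.
Qed.

(** Divided by the size of [F n], the discrepancy bound puts the density within [2 * e n] of
    [alpha]. *)
Lemma discrepancy_le_dens1 (R : realType) (alpha : R) (G : groupType)
    (K : {fset G}) (x : config G) (F : nat -> {fset G}) :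
    (forall A, discrepancy_le alpha K A x) -> Folner R F ->
  (fun n => dens1 R (F n) x) @ \oo --> alpha.
Proof.
move=> xP [F0 /(_ K) FK].
pose e n : R := #|` Fboundary K (F n)|%:R / #|` F n|%:R.
have e0 : 2 * e n @[n --> \oo] --> (0 : R).
  by rewrite -[X in _ --> X](mulr0 2); apply: cvgM; [exact: cvg_cst | exact: FK].
apply: (@squeeze_cvgr _ _ _ _ (fun n => alpha - 2 * e n) (fun n => alpha + 2 * e n)).
- apply: nearW => n; have F_gt0 : 0 < #|` F n|%:R :> R.
    by rewrite ltr0n cardfs_gt0.
  have := xP (F n); rewrite /discrepancy_le /=.
  have -> : \sum_(g <- F n) ((x g)%:R - alpha) =
      #|` F n|%:R * (dens1 R (F n) x - alpha).
    rewrite big_split /= mulrBr /dens1 mulrCA mulfV ?gt_eqF // mulr1.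
    rewrite sumrN big_const_seq count_predT iter_addr addr0 mulr_natl.
    congr (_ - _); rewrite card_fset_sum1 natr_sum -big_fset_condE [RHS]big_mkcond /=.
    by apply: eq_bigr => g _; case: (x g).
  rewrite normrM gtr0_norm // natrM -ler_pdivlMl // mulrCA mulrC -mulrA.
  by rewrite ler_norml /e => ?; lra.
- by rewrite -[X in _ --> X]subr0; apply: cvgB => //; exact: cvg_cst.
- by rewrite -[X in _ --> X]addr0; apply: cvgD => //; exact: cvg_cst.
Qed.

(** * Existence of the subshift by compactness *)

Theorem theorem3p1 (R : realType) (G : groupType)
    (G_infinite : infinite_set [set: G])
    (G_fg : finitely_generated G)
    (G_amenable : amenable R G)
    (alpha : R) (alpha01 : 0 <= alpha <= 1) :
  exists X : set (config G),
    [/\ X !=set0, subshift X &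
      forall x, X x -> forall F : nat -> {fset G}, Folner R F ->
        (fun n => dens1 R (F n) x) @ \oo --> alpha].
Proof.
have [S Sgen] := G_fg.
pose T := (1%g |` (S `|` [fset s^-1%g | s in S]))%fset.
have T1 : 1%g \in T by rewrite !inE eqxx.
have TV t : t \in T -> t^-1%g \in T.
  rewrite !inE => /or3P[/eqP ->|tS|/imfsetP[s sS ->]].
  - by rewrite invg1 eqxx.
  - by apply/or3P/Or33/imfsetP; exists t.
  - by rewrite invgK sS orbT.
have Tgen (H : {pred G}) : group_closed H -> {subset T <= H} -> forall g, g \in H.
  move=> Hgrp TH; apply: Sgen => // s sS; apply: TH.
  by rewrite !inE sS orbT.
pose K := ball T 3.
have TK : {subset T <= K}.
  by move=> t tT; apply: (@ball_mono _ T T1 1 3) => //; apply: ball1.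
exists (\bigcap_(F in [set: {fset G}]) discrepancy_le alpha K F); split.
(* The sets [B W] form a filter base, since [B] of a union lies in both [B U] and [B V]; a cluster
   point of the filter will satisfy all conditions. *)
- pose B (W : {fset G}) : set (config G) :=
    [set x | forall F : {fset G}, {subset F <= W} -> discrepancy_le alpha K F x].
  have Bneq0 W : B W !=set0.
    have [s /andP[us ss] Ws] := coloured_path_cover T1 TV Tgen W.
    have ss' : sorted (fun g h => (g^-1 * h)%g \in K) (map fst s).
      by rewrite sorted_map; apply: sub_sorted ss => p q; apply: step_ball3.
    have [x xP] := path_rounding alpha01 us ss'.
    exists x => F FW; rewrite /discrepancy_le /=.
    have [->|F0] := eqVneq F fset0; first by rewrite big_nil normr0.
    apply: (le_trans (xP F _)); first by move=> g /FW/Ws.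
    rewrite ler_nat mul2n -addnn -addn1 leq_add2l cardfs_gt0.
    exact: Fboundary_neq0 TV Tgen _ _ G_infinite TK F0.
  have B_filter : ProperFilter (filter_from setT B).
    apply: filter_from_proper => //; apply: filter_from_filter.
      by exists fset0.
    move=> U V _ _; exists (U `|` V)%fset => // x xUV.
    by split=> F FS; apply: xUV => g /FS; rewrite inE => ->; rewrite ?orbT.
  have config_compact : compact [set: config G].
    have -> : [set: config G] = [set x | forall g, [set: bool] (x g)].
      by apply/seteqP; split.
    by apply: (@tychonoff G (fun=> bool) (fun=> setT)) => ?; exact: bool_compact.
  have [x [_ xB]] := config_compact _ B_filter filterT.
  (* [x] is in the closure of [B F], which is contained in the closed condition for [F]. *)
  exists x => F _; apply: (@discrepancy_le_closed _ alpha _ K F) => U xU.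
  by apply: xB xU; exists F => // y yF; apply: yF.
- split; first by apply: closed_bigI => F _; exact: discrepancy_le_closed.
  by move=> g _ [x xP <-] F _; apply: discrepancy_le_gshift; apply: xP.
- by move=> x xP F; apply: (@discrepancy_le_dens1 _ _ _ K) => A; exact: xP.
Qed.
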